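(* Let $(X_i)_{i=1}^\infty$ be independent random variables with $X_i\sim\mathrm{Exp}(i)$, and let $M=\sup_{i\ge1}X_i$. Then $$E(M)=\frac{4\sqrt3}{3}\pi-6\approx 1.255,\qquad V(M)=-\frac{28}{3}\pi^2-16\sqrt3\,\pi+180\approx 0.821 .$$
   Context: $\mathrm{Exp}(\lambda)$ denotes the exponential distribution with rate $\lambda$, i.e. density $\lambda e^{-\lambda x}$ on $x\ge0$. $M$ is almost surely finite; its distribution function is $P(M\le t)=\prod_{m=1}^\infty(1-e^{-mt})$ for $t\ge0$. $V$ denotes variance. *)

(* Defs.v *)
From HB Require Import structures.
From mathcomp Require Import all_boot all_order all_algebra finmap.
From mathcomp Require Import all_classical all_reals all_analysis.
Set Implicit Arguments. Unset Strict Implicit. Unset Printing Implicit Defensive.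
Import Order.TTheory GRing.Theory Num.Theory.
Local Open Scope classical_set_scope.
Local Open Scope ring_scope.

Section defs.
Context {d : measure_display} {T : measurableType d} {R : realType}.

Definition mutually_independent (P : probability T R) (X : nat -> T -> R) : Prop :=
  forall (F : {fset nat}) (B : nat -> set R),
    (forall i, i \in F -> measurable (B i)) ->
    P (\bigcap_(i in [set` F]) (X i @^-1` B i))
    = (\big[*%E/1%E]_(i <- F) P (X i @^-1` B i))%E.

Definition esup_family (X : nat -> T -> R) (w : T) : \bar R :=
  ereal_sup (range (fun i => (X i w)%:E)).

(* M = sup_i X_i as a real-valued function (M is a.s. finite; on the null
   set where the sup is +oo, fine gives the junk value 0). *)
Definition sup_family (X : nat -> T -> R) (w : T) : R := fine (esup_family X w).
End defs.

(* Main.v *)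
Require Import Defs.
From HB Require Import structures.
From mathcomp Require Import all_boot all_order all_algebra finmap.
From mathcomp Require Import all_classical all_reals all_analysis.
From mathcomp Require Import measurable_realfun ring lra zify.
Import Order.TTheory GRing.Theory Num.Theory.
Import numFieldNormedType.Exports.
Local Open Scope classical_set_scope.
Local Open Scope ring_scope.

(* Let M_n be the maximum of 0 and of the first n variables.  For t >= 0 its
   distribution function is the product of the 1 - q^m, 1 <= m <= n, with
   q = e^-t.  Shanks' finite form of Euler's pentagonal number theorem writes
   this product as the pentagonal sum truncated at |k| <= n plus a remainder
   bounded by the sum of the q^(sn + s(s+1)/2), 1 <= s <= n.  Integrating the
   tail of M_n (evaluated at t for the first moment, at sqrt t for the second)
   term by term gives
     E(M_n)   = - sum_(0 < |k| <= n) (-1)^k / g_k + o(1),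
     E(M_n^2) = - 2 sum_(0 < |k| <= n) (-1)^k / g_k^2 + o(1),
   with g_k = k(3k-1)/2, and monotone convergence carries this over to M.
   The first series is evaluated with an arctangent primitive.  Adding 12 times
   the first series to the second one turns it into 36 times the sum of the
   c_6(j) / j^2, j > 1, where c_6 is the Ramanujan sum; this is a combination of
   four dilates of the Basel series. *)

(** * Shanks' finite pentagonal identity *)

Definition shanks_term {R : comNzRingType} (q : R) (n s : nat) : R :=
  \prod_(s <= m < n) (1 - q ^+ m.+1) * q ^+ (s * n + 'C(s.+1, 2)).

(* [q ^+ s * (1 - q ^+ n.+1) - 1 = - (1 - q ^+ s) - q ^+ (n.+1 + s)], and the
   factor [1 - q ^+ s] extends the product of [shanks_term q n s] to that of
   [shanks_term q n s.-1]; so the alternating sum telescopes. *)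
Lemma shanks_telescope (R : comNzRingType) (q : R) (n j : nat) : (j <= n)%N ->
  \sum_(s < j.+1) (-1) ^+ s * (shanks_term q n.+1 s - shanks_term q n s) =
  (-1) ^+ j.+1 * (shanks_term q n j * q ^+ (n.+1 + j)).
Proof.
elim: j => [|j IH] jn.
  rewrite big_ord1 /shanks_term big_nat_recr//= !mul0n bin_small// !expr0 addn0.
  by ring.
rewrite big_ord_recr /= IH ?(ltnW jn)// /shanks_term.
rewrite (@big_ltn _ _ _ j n)//= big_nat_recr//=.
have -> : (j.+1 * n.+1 + 'C(j.+2, 2) = (j * n + 'C(j.+1, 2)) + (n.+1 + j) + j.+1)%N.
  by rewrite binS bin1 mulnS mulSn; lia.
have -> : (j.+1 * n + 'C(j.+2, 2) = (j * n + 'C(j.+1, 2)) + (n.+1 + j))%N.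
  by rewrite binS bin1 mulSn; lia.
set e := (j * n + _)%N; rewrite !exprD !exprS.
by ring.
Qed.

(** Induction on n. Passing to n + 1 adds the telescoped differences, which amount to a power with
    exponent (n+1)^2 + C(n+1, 2), and the new term s = n + 1, whose exponent is (n+1)^2 + C(n+2, 2):
    the two pentagonal exponents of k = n + 1. *)
Lemma shanks_pentagonal (R : comNzRingType) (q : R) (n : nat) :
  \sum_(s < n.+1) (-1) ^+ s * shanks_term q n s =
  1 + \sum_(1 <= k < n.+1) (-1) ^+ k *
      (q ^+ (k ^ 2 + 'C(k, 2)) + q ^+ (k ^ 2 + 'C(k.+1, 2))).
Proof.
elim: n => [|n IH].
  by rewrite big_ord1 big_geq// /shanks_term big_geq// bin_small// !expr0; ring.
rewrite big_ord_recr big_nat_recr//= addrA -IH.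
have := @shanks_telescope R q n n (leqnn n).
rewrite (eq_bigr _ (fun i _ => mulrBr _ _ _)) sumrB => /eqP; rewrite subr_eq => /eqP ->.
rewrite /shanks_term !big_geq//.
rewrite -!mulnn.
have -> : (n.+1 * n.+1 + 'C(n.+1, 2) = (n * n + 'C(n.+1, 2)) + (n.+1 + n))%N.
  by rewrite mulnS mulSn; lia.
move: 'C(_, 2) 'C(_, 2) => c1 c2; rewrite !exprD !exprS.
by ring.
Qed.

(** * Evaluation of the two series *)

Lemma scaleRE (R : realType) (a b : R) : a *: b = a * b.
Proof. by []. Qed.

Section trig_constants.
Context {R : realType}.

Lemma sqrt3_gt0 : 0 < Num.sqrt 3 :> R.
Proof. by rewrite sqrtr_gt0. Qed.

Lemma sqr_sqrt3 : Num.sqrt 3 ^+ 2 = 3 :> R.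
Proof. by rewrite sqr_sqrtr. Qed.

(** With x = pi / 6, 0 = cos (3 x) = cos x (4 cos^2 x - 3) forces cos^2 x = 3/4, hence tan^2 x =
    1/3; positivity selects the root. *)
Lemma tan_pisixth : tan (pi / 6) = (Num.sqrt 3)^-1 :> R.
Proof.
have p0 := pi_gt0 R.
have c0 : 0 < cos (pi / 6) :> R by apply: cos_gt0_pihalf; apply/andP; split; lra.
have s0 : 0 < sin (pi / 6) :> R by apply: sin_gt0_pihalf; apply/andP; split; lra.
have : cos (pi / 6 + (pi / 6) *+ 2) = 0 :> R.
  by rewrite (_ : _ + _ = pi / 2) ?cos_pihalf//; field.
rewrite cosD cos_mulr2n sin_mulr2n => /eqP.
rewrite (_ : _ - _ = cos (pi / 6) * (4 * cos (pi / 6) ^+ 2 - 3) :> R); last first.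
  have -> : sin (pi / 6) * ((cos (pi / 6) * sin (pi / 6)) *+ 2) =
     cos (pi / 6) * (2 * sin (pi / 6) ^+ 2) :> R by ring.
  by rewrite sin2cos2; ring.
rewrite mulf_eq0 gt_eqF//= => /eqP c2.
have t2 : tan (pi / 6) ^+ 2 = 3^-1 :> R.
  rewrite /tan expr_div_n sin2cos2.
  have -> : cos (pi / 6) ^+ 2 = 3 / 4 :> R by lra.
  by field.
apply/eqP; rewrite -(@eqrXn2 _ 2)//.
- by rewrite t2 exprVn sqr_sqrt3.
- by rewrite /tan divr_ge0// ltW.
Qed.

Lemma atan_invsqrt3 : atan (Num.sqrt 3)^-1 = pi / 6 :> R.
Proof.
have p0 := pi_gt0 R.
by rewrite -tan_pisixth tanK// in_itv/=; apply/andP; split; lra.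
Qed.

End trig_constants.

(** * The alternating sum of the reciprocals of the pentagonal numbers *)

Section first_series.
Context {R : realType}.

Lemma is_derive_monomial (c : R) (n : nat) (x : R) :
  is_derive x 1 (fun y => c * (y ^+ n.+1 / n.+1%:R)) (c * x ^+ n).
Proof.
rewrite (_ : (fun y => _) = (c / n.+1%:R) \*: (@id R) ^+ n.+1); last first.
  by apply/funext => y; rewrite !fctE/= scaleRE mulrAC mulrA.
apply: (is_derive_eq (is_deriveZ (c / n.+1%:R) (is_deriveX n.+1 (is_derive_id x 1)))).
by rewrite !scaleRE mulr1 mulrA mulfVK ?pnatr_eq0.
Qed.

(** [pent_lo k] and [pent_hi k] are the generalized pentagonal numbers g_k and g_(-k). *)
Definition pent_lo (k : nat) : R := k%:R * (3 * k%:R - 1) / 2.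
Definition pent_hi (k : nat) : R := k%:R * (3 * k%:R + 1) / 2.

Definition pent_sum (p n : nat) : R :=
  \sum_(1 <= k < n.+1) (-1) ^+ k * (pent_lo k ^- p + pent_hi k ^- p).

(* [f n] is a primitive of a geometric sum, whose limit has primitive [G]. *)
Let f (n : nat) : R -> R := \sum_(k < n)
  ((fun x => (-1) ^+ k.+1 * (x ^+ (3 * k).+2 / (3 * k).+2%:R)) +
   (fun x => (-1) ^+ k * (x ^+ (3 * k).+4 / (3 * k).+4%:R))).

Let quad_gt0 (x : R) : 0 < 1 - x + x ^+ 2.
Proof. by nra. Qed.

(** The derivative is the geometric sum of - (x - x^3) (- x^3)^k, k < n; in the closed form the
    factor 1 + x of 1 - x^2 cancels against that of 1 + x^3. *)
Let is_derive_f n (x : R) :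
  is_derive x 1 (f n) (- x * (1 - x) * (1 - (- x ^+ 3) ^+ n) / (1 - x + x ^+ 2)).
Proof.
elim: n => [|n IH].
  rewrite /f big_ord0; apply: (is_derive_eq (is_derive_cst 0 x 1)).
  by rewrite expr0 subrr mulr0 mul0r.
rewrite /f big_ord_recr/=.
have d1 := is_derive_monomial ((-1) ^+ n.+1) (3 * n).+1 x.
have d2 := is_derive_monomial ((-1) ^+ n) (3 * n).+3 x.
apply: (is_derive_eq (is_deriveD IH (is_deriveD d1 d2))).
have q0 := lt0r_neq0 (quad_gt0 x).
rewrite (exprSr (- x ^+ 3)) (_ : (- x ^+ 3) ^+ n = (-1) ^+ n * x ^+ (3 * n)); last first.
  by rewrite [LHS]exprNn -exprM.
rewrite !exprS; move: (3 * n)%N ((-1) ^+ n) => m e.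
by field.
Qed.

Let G : R -> R := id - (2 / Num.sqrt 3) \*:
  (atan \o (fun x => (2 * x - 1) / Num.sqrt 3)).

(** The derivative is 1 - 1 / (1 - x + x^2), and completing the square, 4 (1 - x + x^2) = (2 x -
    1)^2 + 3, produces the arctangent. *)
Let is_derive_G (x : R) :
  is_derive x 1 G (- x * (1 - x) / (1 - x + x ^+ 2)).
Proof.
have q0 := lt0r_neq0 (quad_gt0 x).
have r0 := lt0r_neq0 (@sqrt3_gt0 R).
have d : is_derive x 1 (fun x : R => (2 * x - 1) / Num.sqrt 3) (2 / Num.sqrt 3).
  rewrite (_ : (fun x => _) = (2 / Num.sqrt 3) \*: (@id R) - cst (Num.sqrt 3)^-1).
    by apply: is_derive_eq; rewrite subr0 scaleRE mulr1.
  by apply/funext => y; rewrite !fctE/= scaleRE; field.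
have da : is_derive x 1 (atan \o (fun x : R => (2 * x - 1) / Num.sqrt 3)) _ :=
  is_derive1_comp (is_derive1_atan _) d.
apply: (is_derive_eq (is_deriveB (is_derive_id x 1) (is_deriveZ (2 / Num.sqrt 3) da))).
rewrite !scaleRE expr_div_n sqr_sqrt3.
have -> : (1 + (2 * x - 1) ^+ 2 / 3)^-1 = 3 / 4 / (1 - x + x ^+ 2).
  by field; rewrite q0/=; apply: lt0r_neq0; have := quad_gt0 x; nra.
have -> : (2 / Num.sqrt 3) * (3 / 4 / (1 - x + x ^+ 2) * (2 / Num.sqrt 3)) =
   3 / Num.sqrt 3 ^+ 2 / (1 - x + x ^+ 2) by field; rewrite q0 r0.
by rewrite sqr_sqrt3; field.
Qed.

(** Each of the n + 1 terms of (1 - x^(n+1)) / (1 - x) = 1 + x + ... + x^n is at least x^n. This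
    makes x^n (1 - x) of order 1/n uniformly on [0, 1]. *)
Let monomial_bound (n : nat) (x : R) : 0 <= x <= 1 ->
  n.+1%:R * x ^+ n * (1 - x) <= 1 - x ^+ n.+1.
Proof.
move=> /andP[x0 x1]; elim: n => [|n IH]; first by rewrite expr0 expr1 !mul1r.
have xn0 : 0 <= x ^+ n.+1 by rewrite exprn_ge0.
have xn1 : x ^+ n.+1 <= 1 by rewrite exprn_ile1.
have := ler_wpM2l x0 IH; rewrite -natr1 !exprS in xn0 xn1 *.
by set a : R := n.+1%:R; set y := x ^+ n in xn0 xn1 *; nra.
Qed.

(** Pairing k with -k, 1/g_k + 1/g_(-k) = 12 / (9 k^2 - 1) = 6 (1/(3k - 1) - 1/(3k + 1)). *)
Lemma pent_sum1E n : pent_sum 1 n = 6 * f n 1 :> R.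
Proof.
rewrite /pent_sum /f fct_sumE mulr_sumr big_add1 big_mkord.
apply: eq_bigr => k _; rewrite !fctE !expr1n !expr1 /pent_lo /pent_hi.
have k0 := ler0n R k.
have -> : (3 * k).+2%:R = 3 * k%:R + 2 :> R by rewrite -!natr1 natrM; ring.
have -> : (3 * k).+4%:R = 3 * k%:R + 4 :> R by rewrite -!natr1 natrM; ring.
rewrite -natr1 exprS.
by field; repeat (apply/andP; split => //); apply: lt0r_neq0; lra.
Qed.

Lemma pent_sum1_cvg :
  (pent_sum 1 n : R) @[n --> \oo] --> (6 - 4 * pi / Num.sqrt 3 : R).
Proof.
have r0 := lt0r_neq0 (@sqrt3_gt0 R).
have bound n : `|pent_sum 1 n - (6 - 4 * pi / Num.sqrt 3)| <= 6 * n.+1%:R^-1 :> R.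
  have dh x := is_deriveB (is_derive_f n x) (is_derive_G x).
  (* The mean value theorem for [f n - G] on [0, 1] turns the error into one value of the remainder
     of the geometric sum, up to sign c^(3n+1) (1 - c) / (1 - c + c^2). *)
  have [|c] := @MVT R _ _ 0 1 ltr01 (fun x _ => dh x).
    by apply: derivable_within_continuous => x _; exact: (@ex_derive _ _ _ _ _ _ _ (dh x)).
  rewrite in_itv/= => /andP[c0 c1].
  have f0 : f n 0 = 0.
    rewrite /f fct_sumE big1// => k _.
    by rewrite !fctE !expr0n/= !mul0r !mulr0 addr0.
  have G10 : G 1 - G 0 = 1 - 2 * pi / (3 * Num.sqrt 3).
    rewrite /G !fctE/= !scaleRE mulr0 !sub0r mulr1.
    rewrite (_ : 2 - 1 = 1); last by ring.
    rewrite mulN1r mul1r atanN atan_invsqrt3.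
    by field.
  rewrite !fctE f0 subr0 mulr1 => h.
  have -> : pent_sum 1 n - (6 - 4 * pi / Num.sqrt 3) = 6 * (f n 1 - G 1 - (0 - G 0)).
    rewrite (_ : f n 1 - G 1 - (0 - G 0) = f n 1 - (G 1 - G 0)); last by ring.
    by rewrite G10 pent_sum1E; field.
  rewrite h normrM (@ger0_norm _ 6)// ler_pM2l//.
  have q0 := quad_gt0 c.
  have -> : - c * (1 - c) * (1 - (- c ^+ 3) ^+ n) / (1 - c + c ^+ 2) -
       - c * (1 - c) / (1 - c + c ^+ 2) =
       (-1) ^+ n * (c ^+ (3 * n).+1 * (1 - c) / (1 - c + c ^+ 2)).
    rewrite (exprNn (c ^+ 3)) -exprM (exprS c (3 * n)); field; exact: lt0r_neq0.
  rewrite normrM normrX normrN1 expr1n mul1r ger0_norm; last first.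
    by rewrite divr_ge0 ?(ltW q0)// mulr_ge0 ?exprn_ge0 ?subr_ge0 ?ltW.
  rewrite ler_pdivrMr// [leRHS]mulrC ler_pdivlMr ?ltr0n//.
  (* The numerator is at most 1 / (3n + 2) and the denominator at least 3/4; then (3/4) (3n + 2) >=
     n + 1 yields the bound 1 / (n + 1). *)
  have := @monomial_bound (3 * n).+1 c; rewrite (ltW c0) (ltW c1) => /(_ isT).
  have -> : (3 * n).+2%:R = 3 * n%:R + 2 :> R by rewrite -!natr1 natrM; ring.
  rewrite -natr1.
  set y := c ^+ _ => Y.
  have y0 : 0 <= y * (1 - c) by rewrite mulr_ge0 ?exprn_ge0 ?subr_ge0 ?ltW.
  have cy : 0 <= c ^+ (3 * n).+2 by rewrite exprn_ge0 ?ltW.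
  have n0 := ler0n R n.
  have q34 : 3 / 4 <= 1 - c + c ^+ 2 by have := sqr_ge0 (c - 1 / 2); lra.
  have nz := mulr_ge0 n0 y0.
  by rewrite -mulrA in Y; lra.
apply/cvgrPdist_le => e e0; near=> n.
rewrite distrC (le_trans (bound n))//.
near: n; have /cvgrPdist_le/(_ (e / 6)) := @cvg_harmonic R.
case=> [|N _ NP]; first by rewrite divr_gt0.
exists N => // n /NP/=; rewrite sub0r normrN ger0_norm ?harmonic_ge0//.
by rewrite ler_pdivlMr// mulrC.
Unshelve. all: by end_near. Qed.

End first_series.

(** * The Basel sum and the alternating sum of the inverse squares of the pentagonal numbers *)

Section second_series.
Context {R : realType}.

Definition inv_sq_sum (n : nat) : R := \sum_(k < n) k.+1%:R ^- 2.

(** By the mean value theorem sin x = x cos c with 0 < c < x. Squared and inverted, this becomes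
    1/x^2 <= 1/sin^2 x <= 1 + 1/x^2. *)
Let sin_between (x : R) : 0 < x < pi / 2 -> x * cos x <= sin x <= x.
Proof.
move=> /andP[x0 xpi]; have p0 := pi_gt0 R.
have [|c] := @MVT R _ _ 0 x x0 (fun y _ => is_derive_sin y).
  exact/continuous_subspaceT/continuous_sin.
rewrite in_itv/= sin0 !subr0 => /andP[c0 cx] ->.
rewrite mulrC ler_pM2r// ger_pMl// cos_le1 andbT.
rewrite ltW// ltr_cos// in_itv/=; apply/andP; split; lra.
Qed.

(* [4 / sin (2 t) ^+ 2 = 1 / sin t ^+ 2 + 1 / cos t ^+ 2], and the cosines of the
   halved angles are the sines of the second half of the new angles, taken in
   reverse order. *)
Let inv_sin_sq_sum (n : nat) :
  \sum_(k < 2 ^ n) sin ((2 * k%:R + 1) * pi / (2 ^ n.+2)%:R) ^- 2 = (2 * 4 ^ n)%:R :> R.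
Proof.
elim: n => [|n IH].
  rewrite big_ord1 /= mulr0 add0r mul1r.
  have c4 : cos (pi / 4) != 0 :> R.
    have p0 := pi_gt0 R.
    by apply/lt0r_neq0/cos_gt0_pihalf; apply/andP; split; lra.
  have sc : sin (pi / 4) = cos (pi / 4) :> R.
    by rewrite -[LHS](divfK c4) -/(tan _) tan_piquarter mul1r.
  have := cos2Dsin2 (pi / 4 : R); rewrite -sc => h.
  have -> : sin (pi / 4) ^+ 2 = 2^-1 :> R by lra.
  by rewrite invrK.
rewrite expnS mul2n -addnn big_split_ord/=.
rewrite [X in _ + X](reindex_inj rev_ord_inj)/= -big_split/=.
rewrite (expnS 4) mulnCA natrM -IH mulr_sumr; apply: eq_bigr => k _.
set t := (2 * k%:R + 1) * pi / (2 ^ n.+3)%:R.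
have p0 := pi_gt0 R.
have n0 : (2 ^ n)%:R != 0 :> R by rewrite pnatr_eq0 expn_eq0.
have -> : (2 * (2 ^ n + (2 ^ n - k.+1))%:R + 1) * pi / (2 ^ n.+3)%:R = pi / 2 - t.
  rewrite natrD natrB// /t !expnS !natrM -natr1; field => //.
have -> : (2 * k%:R + 1) * pi / (2 ^ n.+2)%:R = t *+ 2.
  by rewrite /t !expnS !natrM; field => //.
have kn : k%:R + 1 <= (2 ^ n)%:R :> R by rewrite natr1 ler_nat.
have k0 := ler0n R k.
have t0 : 0 < t.
  by rewrite /t divr_gt0 ?ltr0n ?expn_gt0// mulr_gt0//; lra.
have tpi : t < pi / 2.
  rewrite /t ltr_pdivrMr ?ltr0n ?expn_gt0// !expnS !natrM.
  by nra.
have s0 : sin t != 0 by apply/lt0r_neq0/sin_gt0_pihalf; rewrite t0.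
have c0 : cos t != 0.
  by apply/lt0r_neq0/cos_gt0_pihalf; apply/andP; split; lra.
rewrite -[pi / 2 - t]opprB sinN sinBpihalf opprK sin_mulr2n.
have := cos2Dsin2 t => cs.
have -> : 4 * (cos t * sin t *+ 2) ^- 2 = (cos t ^+ 2 + sin t ^+ 2) * (cos t * sin t) ^- 2.
  by rewrite cs; field; rewrite s0 c0.
by field; rewrite s0 c0.
Qed.

(** Summing 1/x^2 <= 1/sin^2 x <= 1 + 1/x^2 over the 2^n angles x_k = (2k + 1) pi / 2^(n+2) puts the
    sum of the 1/x_k^2 between 2 * 4^n - 2^n and 2 * 4^n; scaling by pi^2 / (16 * 4^n) gives the odd
    sum. *)
Let odd_sum_bounds (n : nat) :
  @pi R ^+ 2 / 8 - @pi R ^+ 2 / 16 * (2 ^ n)%:R^-1 <=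
  \sum_(k < 2 ^ n) (k.*2.+1)%:R ^- 2 <= @pi R ^+ 2 / 8.
Proof.
have p0 := pi_gt0 R.
have n0 : 0 < (2 ^ n)%:R :> R by rewrite ltr0n expn_gt0.
pose x (k : nat) : R := (2 * k%:R + 1) * pi / (2 ^ n.+2)%:R.
have xE (k : nat) : x k ^- 2 = 16 * (2 ^ n)%:R ^+ 2 / pi ^+ 2 * k.*2.+1%:R ^- 2.
  have -> : k.*2.+1%:R = 2 * k%:R + 1 :> R by rewrite -natr1 -mul2n natrM.
  have k1 : 2 * k%:R + 1 != 0 :> R by rewrite lt0r_neq0// ltr_wpDl// mulr_ge0.
  (* [field] would unfold [pi], which is therefore generalized. *)
  rewrite /x !expnS !natrM; move: (@pi R) p0 => p p0.
  by field; rewrite k1 !lt0r_neq0.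
have xb (k : 'I_(2 ^ n)) : x k ^- 2 <= sin (x k) ^- 2 <= 1 + x k ^- 2.
  have kn : k%:R + 1 <= (2 ^ n)%:R :> R by rewrite natr1 ler_nat.
  have k0 := ler0n R k.
  have x0 : 0 < x k.
    by rewrite /x divr_gt0 ?ltr0n ?expn_gt0// mulr_gt0//; lra.
  have xpi : x k < pi / 2.
    by rewrite /x ltr_pdivrMr ?ltr0n ?expn_gt0// !expnS !natrM; nra.
  have := @sin_between (x k); rewrite x0 xpi => /(_ isT)/andP[h1 h2].
  have s0 : 0 < sin (x k) by apply: sin_gt0_pihalf; rewrite x0.
  have c0 : 0 <= cos (x k) by apply: cos_ge0_pihalf; apply/andP; split; lra.
  apply/andP; split.
    by rewrite lef_pV2 ?posrE ?exprn_gt0// ler_pXn2r ?nnegrE ?(ltW s0) ?(ltW x0).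
  (* Once sin^2 is cleared and 1 is written as cos^2 + sin^2, what remains is the square of x cos x
     <= sin x. *)
  rewrite -[leLHS]mul1r ler_pdivrMr ?exprn_gt0// mulrDl mul1r.
  rewrite -[leLHS](cos2Dsin2 (x k)) addrC lerD2l [leRHS]mulrC ler_pdivlMr ?exprn_gt0//.
  by rewrite -exprMn mulrC ler_pXn2r// nnegrE ?mulr_ge0// ltW.
set O := \sum_(k < _) _.
have xO : \sum_(k < 2 ^ n) x k ^- 2 = 16 * (2 ^ n)%:R ^+ 2 / pi ^+ 2 * O.
  by rewrite mulr_sumr; apply: eq_bigr => k _; rewrite xE.
have sE := inv_sin_sq_sum n.
have l1 : \sum_(k < 2 ^ n) x k ^- 2 <= 2 * (2 ^ n)%:R ^+ 2.
  rewrite -natrX -expnM mulnC expnM -natrM -sE.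
  by apply: ler_sum => k _; have /andP[] := xb k.
have l2 : 2 * (2 ^ n)%:R ^+ 2 <= (2 ^ n)%:R + \sum_(k < 2 ^ n) x k ^- 2.
  rewrite -natrX -expnM mulnC expnM -natrM -sE.
  rewrite -[X in X%:R + _]card_ord -sumr_const -big_split/=.
  by apply: ler_sum => k _; have /andP[] := xb k.
rewrite {}xO in l1 l2.
move: (@pi R) p0 l1 l2 => p {x xE xb} p0 l1 l2.
have pp : 0 < p ^+ 2 by rewrite exprn_gt0.
have E : O = (16 * (2 ^ n)%:R ^+ 2 / p ^+ 2 * O) * (p ^+ 2 / (16 * (2 ^ n)%:R ^+ 2)).
  by field; rewrite !lt0r_neq0.
have q0 : 0 <= p ^+ 2 / (16 * (2 ^ n)%:R ^+ 2) :> R.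
  by rewrite divr_ge0 ?ltW// mulr_gt0 ?exprn_gt0.
apply/andP; split.
  rewrite E; rewrite -lerBlDl in l2; apply: le_trans (ler_wpM2r q0 l2).
  rewrite le_eqVlt; apply/orP; left; apply/eqP; field.
  by rewrite !lt0r_neq0.
rewrite E; apply: le_trans (ler_wpM2r q0 l1) _.
rewrite le_eqVlt; apply/orP; left; apply/eqP; field.
by rewrite !lt0r_neq0.
Qed.

Lemma odd_sum_cvg :
  (\sum_(k < 2 ^ n) (k.*2.+1)%:R ^- 2 : R) @[n --> \oo] --> pi ^+ 2 / 8.
Proof.
apply: (@squeeze_cvgr _ _ _ _ (fun n => pi ^+ 2 / 8 - pi ^+ 2 / 16 * (2 ^ n)%:R^-1)
  (fun=> pi ^+ 2 / 8)).
- by near=> n; exact: odd_sum_bounds.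
- rewrite -[X in _ --> X]subr0 -[X in _ - X](mulr0 (pi ^+ 2 / 16)).
  apply: cvgB; first exact: cvg_cst.
  apply: cvgMr.
  rewrite (_ : (fun n => _) = GRing.exp (2^-1 : R)).
    by apply: cvg_expr; rewrite ger0_norm ?invr_ge0// invf_lt1// ltr1n.
  by apply/funext => n; rewrite natrX exprVn.
- exact: cvg_cst.
Unshelve. all: by end_near. Qed.

Lemma inv_sq_sumS n : inv_sq_sum n.+1 = inv_sq_sum n + n.+1%:R ^- 2.
Proof. by rewrite /inv_sq_sum big_ord_recr. Qed.

(** The partial sums increase and stay below 2 by telescoping, so a limit z exists. Splitting the
    sum up to 2^(n+1) into odd and even terms gives z = pi^2/8 + z/4; powers of two suffice once z
    is known to exist. *)
Lemma basel : inv_sq_sum n @[n --> \oo] --> pi ^+ 2 / 6.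
Proof.
have nd : nondecreasing_seq inv_sq_sum.
  by apply/nondecreasing_seqP => n; rewrite inv_sq_sumS lerDl invr_ge0 exprn_ge0.
have ub n : inv_sq_sum n.+1 <= 2 - n.+1%:R^-1.
  elim: n => [|n IH].
    by rewrite /inv_sq_sum big_ord1 expr1n invr1; lra.
  rewrite inv_sq_sumS (le_trans (lerD IH (lexx _)))//.
  rewrite -(natr1 n.+1); have : 0 < n.+1%:R :> R by [].
  move: n.+1%:R => x x0; rewrite -subr_ge0.
  have -> : 2 - (x + 1)^-1 - (2 - x^-1 + (x + 1) ^- 2) = (x * (x + 1) ^+ 2)^-1.
    by field; rewrite lt0r_neq0 ?addr_gt0//= lt0r_neq0.
  by rewrite invr_ge0 mulr_ge0 ?exprn_ge0 ?addr_ge0 ?ltW.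
have /cvg_ex[/= z Hz] : cvgn inv_sq_sum.
  apply: nondecreasing_is_cvgn => //; exists 2 => _ [n _ <-].
  rewrite (le_trans (nd _ _ (leqnSn n)))// (le_trans (ub n))//.
  by rewrite gerBl invr_ge0.
have pow2 : (2 ^ n)%N @[n --> \oo] --> \oo.
  apply/cvgnyPge => A; near=> n; rewrite (leq_trans _ (ltnW (ltn_expl n _)))//.
  by near: n; exact: nbhs_infty_ge.
have Hz1 : inv_sq_sum (2 ^ n) @[n --> \oo] --> z by exact: (cvg_comp _ _ pow2 Hz).
have double n : inv_sq_sum n.*2 = \sum_(k < n) (k.*2.+1)%:R ^- 2 + inv_sq_sum n / 4.
  elim: n => [|n IH]; first by rewrite /inv_sq_sum !big_ord0 mul0r addr0.
  rewrite doubleS !inv_sq_sumS IH big_ord_recr/= (_ : n.*2.+2%:R = 2 * n.+1%:R :> R).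
    have : n.+1%:R != 0 :> R by [].
    have : n.*2.+1%:R != 0 :> R by [].
    by move: n.+1%:R n.*2.+1%:R => x y x0 y0; field; rewrite x0 y0.
  by rewrite -doubleS -mul2n natrM.
have Hz2 : inv_sq_sum (2 ^ n).*2 @[n --> \oo] --> z.
  under eq_fun do rewrite -mul2n -expnS.
  by rewrite -(cvg_shiftS (fun n => inv_sq_sum (2 ^ n))) in Hz1.
have Hz3 : inv_sq_sum (2 ^ n).*2 @[n --> \oo] --> pi ^+ 2 / 8 + z / 4.
  under eq_fun do rewrite double.
  by apply: cvgD; [exact: odd_sum_cvg|apply: cvgMl].
suff -> : pi ^+ 2 / 6 = z by [].
have zE : z = pi ^+ 2 / 8 + z / 4 by exact: (cvg_unique _ Hz2 Hz3).
by move: (pi ^+ 2) zE => p zE; lra.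
Unshelve. all: by end_near. Qed.

(** Squaring 1/(k (3k - 1)) = 3/(3k - 1) - 1/k gives 1/g_k^2 + 12/g_k = 36 ((3k - 1)^-2 + (3k)^-2),
    and likewise for -k: the factor 12 is the one that removes the cross terms. *)
Lemma pent_sum21 n : pent_sum 2 n + 12 * pent_sum 1 n =
  36 * \sum_(1 <= k < n.+1) (-1) ^+ k *
    ((3 * k%:R - 1) ^- 2 + 2 * (3 * k%:R) ^- 2 + (3 * k%:R + 1) ^- 2) :> R.
Proof.
rewrite /pent_sum !mulr_sumr -big_split/= big_add1 [in RHS]big_add1.
apply: eq_bigr => k _; rewrite -natr1 /pent_lo /pent_hi expr1.
have k0 := ler0n R k.
have h1 : k%:R + 1 != 0 :> R by apply: lt0r_neq0; lra.
have h2 : 3 * (k%:R + 1) - 1 != 0 :> R by apply: lt0r_neq0; lra.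
have h3 : 3 * (k%:R + 1) + 1 != 0 :> R by apply: lt0r_neq0; lra.
by field; rewrite !(addrC 1) h1 h2 h3.
Qed.

(* The right-hand side is 36 times the sum of the [c j / j ^ 2] for
   [2 <= j <= 6 m + 1], with [c j = 1 - 2 [2 | j] - 3 [3 | j] + 6 [6 | j]]. *)
Lemma pent_sum2_double m : pent_sum 2 m.*2 + 12 * pent_sum 1 m.*2 =
  36 * (inv_sq_sum (6 * m) - inv_sq_sum (3 * m) / 2 - inv_sq_sum (2 * m) / 3
    + inv_sq_sum m / 6 + (6 * m%:R + 1) ^- 2 - 1).
Proof.
rewrite pent_sum21; congr (_ * _).
elim: m => [|m IH].
  by rewrite big_geq// !muln0 /inv_sq_sum !big_ord0 mulr0; field.
rewrite doubleS (@big_nat_recr _ _ _ m.*2.+2)// (@big_nat_recr _ _ _ m.*2.+1)// {}IH.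
rewrite !mulnS !addSn !add0n !inv_sq_sumS.
rewrite /= (exprS _ m.*2.+1) (exprS _ m.*2) -signr_odd odd_double expr0.
rewrite -mul2n -!natr1 !natrM.
have x0 := ler0n R m; move: (m%:R) x0 => x x0.
by field; repeat (apply/andP; split); apply: lt0r_neq0; lra.
Qed.

(** The four dilates all tend to pi^2/6, with total weight 1 - 1/2 - 1/3 + 1/6 = 1/3. The limit is
    therefore 36 (pi^2/18 - 1) minus 12 times that of [pent_sum 1]. *)
Lemma pent_sum2_double_cvg : (pent_sum 2 m.*2 : R) @[m --> \oo] -->
  2 * pi ^+ 2 - 108 + 48 * pi / Num.sqrt 3.
Proof.
have mul_cvg (a : nat) : (0 < a)%N -> (a * m)%N @[m --> \oo] --> \oo.
  move=> a0; apply/cvgnyPge => A; near=> m.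
  by rewrite (leq_trans _ (leq_pmull _ a0))//; near: m; exact: nbhs_infty_ge.
have H a : (0 < a)%N -> inv_sq_sum (a * m) @[m --> \oo] --> pi ^+ 2 / 6.
  by move=> /mul_cvg a0; exact: (cvg_comp _ _ a0 basel).
have D : (pent_sum 1 m.*2 : R) @[m --> \oo] --> 6 - 4 * pi / Num.sqrt 3.
  rewrite (_ : (fun m => _) = (fun m => pent_sum 1 (2 * m))); last first.
    by apply/funext => m; rewrite mul2n.
  exact: (cvg_comp _ _ (mul_cvg 2 isT) pent_sum1_cvg).
have tail : (6 * m%:R + 1 : R) ^- 2 @[m --> \oo] --> 0.
  apply: (@squeeze_cvgr _ _ _ _ (fun=> 0) harmonic).
  - near=> m; rewrite invr_ge0 exprn_ge0 ?addr_ge0 ?mulr_ge0//=.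
    have m0 := ler0n R m.
    rewrite lef_pV2 ?posrE ?exprn_gt0 ?ltr0n ?ltr_wpDl ?mulr_ge0//.
    by rewrite -natr1; nra.
  - exact: cvg_cst.
  - exact: cvg_harmonic.
have E m : pent_sum 2 m.*2 =
  36 * (inv_sq_sum (6 * m) - inv_sq_sum (3 * m) / 2 - inv_sq_sum (2 * m) / 3
    + inv_sq_sum (1 * m) / 6 + (6 * m%:R + 1) ^- 2 - 1) - 12 * pent_sum 1 m.*2.
  by rewrite mul1n -pent_sum2_double addrK.
rewrite (funext E).
rewrite [X in _ --> X](_ : _ = 36 * (pi ^+ 2 / 6 - pi ^+ 2 / 6 / 2 - pi ^+ 2 / 6 / 3
   + pi ^+ 2 / 6 / 6 + 0 - 1) - 12 * (6 - 4 * pi / Num.sqrt 3)); last first.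
  by move: (@pi R) (@sqrt3_gt0 R) => p s; field; exact: lt0r_neq0.
apply: cvgB; last exact: cvgMr.
apply: cvgMr; apply: cvgB; last exact: cvg_cst.
apply: cvgD => //; apply: cvgD; last by apply: cvgMl; exact: H.
apply: cvgB; last by apply: cvgMl; exact: H.
by apply: cvgB; [|apply: cvgMl]; exact: H.
Unshelve. all: by end_near. Qed.

End second_series.

(** * Integration of the tail *)

Section integrate_product.
Context d (T : measurableType d) (R : realType).
Variables (mu : {measure set T -> \bar R}) (A : set T).
Hypothesis mA : measurable A.

Lemma Rintegral_sum (I : eqType) (s : seq I) (F : I -> T -> R) :
  (forall i, i \in s -> mu.-integrable A (EFin \o F i)) ->
  mu.-integrable A (EFin \o (fun x => \sum_(i <- s) F i x)) /\
  \int[mu]_(x in A) (\sum_(i <- s) F i x) = \sum_(i <- s) \int[mu]_(x in A) F i x.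
Proof.
elim: s => [|i s IH] Fi.
  rewrite big_nil; under eq_Rintegral do rewrite big_nil.
  rewrite /Rintegral integral0; split=> //.
  rewrite (_ : _ \o _ = cst 0%E); first exact: integrable0.
  by apply/funext => x /=; rewrite big_nil.
have [|sint sE] := IH; first by move=> j js; apply: Fi; rewrite inE js orbT.
have iint : mu.-integrable A (EFin \o F i) by apply: Fi; rewrite mem_head.
rewrite big_cons -sE -RintegralD//; split; last first.
  by apply: eq_Rintegral => x _; rewrite big_cons.
rewrite (_ : _ \o _ = (EFin \o F i) \+ (EFin \o (fun x => \sum_(i <- s) F i x))).
  exact: integrableD.
by apply/funext => x /=; rewrite big_cons EFinD.
Qed.

(** Keeping [q] abstract serves both moments: q = exp(-t) with c n = 1/n, and q = exp(- sqrt t) with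
    c n = 2/n^2. *)
Variables (q : T -> R) (c : nat -> R).
Hypothesis mq : measurable_fun A q.
Hypothesis q01 : forall x, A x -> 0 <= q x <= 1.
Hypothesis int_q : forall n, (0 < n)%N ->
  (\int[mu]_(x in A) (q x ^+ n)%:E = (c n)%:E)%E.

Let integrable_q n : (0 < n)%N -> mu.-integrable A (EFin \o (fun x => q x ^+ n)).
Proof.
move=> n0; apply/integrableP; split.
  by apply/measurable_EFinP; exact: measurable_funX.
under eq_integral => x /set_mem Ax.
  have /andP[qx0 _] := q01 _ Ax.
  by rewrite /= ger0_norm ?exprn_ge0//; over.
by rewrite int_q// ltry.
Qed.

Let Rint_q n : (0 < n)%N -> \int[mu]_(x in A) (q x ^+ n) = c n.
Proof. by move=> n0; rewrite /Rintegral int_q. Qed.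

Let shanks_term_bound n s x : A x ->
  `|shanks_term (q x) n s| <= q x ^+ (s * n + 'C(s.+1, 2)).
Proof.
move=> Ax; have /andP[q0 q1] := q01 _ Ax.
rewrite /shanks_term normrM [X in _ * X]ger0_norm ?exprn_ge0// ler_piMl ?exprn_ge0//.
rewrite normr_prod prodr_ile1// => i _; rewrite normr_ge0/=.
rewrite ger0_norm ?subr_ge0 ?exprn_ile1//.
by rewrite gerBl exprn_ge0.
Qed.

Let integrable_shanks n s : (0 < s)%N ->
  mu.-integrable A (EFin \o (fun x => shanks_term (q x) n s)).
Proof.
move=> s0; have e0 : (0 < s * n + 'C(s.+1, 2))%N by rewrite addn_gt0 bin_gt0 orbC ltnS s0.
apply: (le_integrable mA _ _ (integrable_q _ e0)).
  apply/measurable_EFinP; apply: measurable_funM; last exact: measurable_funX.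
  apply: measurable_prod => i _.
  by apply: measurable_funB => //; exact: measurable_funX.
move=> x Ax /=; rewrite lee_fin (le_trans (shanks_term_bound _ _ _ Ax))//.
exact: ler_norm.
Qed.

(** In Shanks' identity the term s = 0 is the product itself. Moving it across leaves only terms
    with positive powers of q, all integrable: the pentagonal part integrates exactly, and the terms
    s >= 1 are dominated by powers of q and form the error. *)
Lemma integral_prod_pentagonal n :
  mu.-integrable A (EFin \o (fun x => 1 - \prod_(i < n) (1 - q x ^+ i.+1))) /\
  `|\int[mu]_(x in A) (1 - \prod_(i < n) (1 - q x ^+ i.+1)) +
    \sum_(1 <= k < n.+1) (-1) ^+ k * (c (k ^ 2 + 'C(k, 2)) + c (k ^ 2 + 'C(k.+1, 2)))|
  <= \sum_(1 <= s < n.+1) c (s * n + 'C(s.+1, 2)).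
Proof.
pose S x := \sum_(1 <= s < n.+1) (-1) ^+ s * shanks_term (q x) n s.
pose E x := \sum_(1 <= k < n.+1) (-1) ^+ k *
  (q x ^+ (k ^ 2 + 'C(k, 2)) + q x ^+ (k ^ 2 + 'C(k.+1, 2))).
have SE x : 1 - \prod_(i < n) (1 - q x ^+ i.+1) = S x - E x.
  have := shanks_pentagonal _ (q x) n;
  rewrite -(big_mkord xpredT (fun s => (-1) ^+ s * shanks_term (q x) n s)) big_ltn//= expr0 mul1r.
  rewrite {1}/shanks_term mul0n bin_small// expr0 mulr1 big_mkord -/(S x) -/(E x).
  by move=> h; lra.
have ksq k : k \in index_iota 1 n.+1 -> (0 < k ^ 2)%N.
  by rewrite mem_index_iota expn_gt0 => /andP[->].
have intS s : s \in index_iota 1 n.+1 ->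
    mu.-integrable A (EFin \o (fun x => (-1) ^+ s * shanks_term (q x) n s)).
  rewrite mem_index_iota => /andP[s0 _].
  exact: (integrableZl mA ((-1) ^+ s) (integrable_shanks n _ s0)).
have intEk k : k \in index_iota 1 n.+1 -> mu.-integrable A (EFin \o (fun x =>
    q x ^+ (k ^ 2 + 'C(k, 2)) + q x ^+ (k ^ 2 + 'C(k.+1, 2)))).
  move=> /ksq k0.
  by apply: (integrableD mA (integrable_q (k ^ 2 + 'C(k, 2)) _)
    (integrable_q (k ^ 2 + 'C(k.+1, 2)) _)); rewrite addn_gt0 k0.
have intE k : k \in index_iota 1 n.+1 -> mu.-integrable A (EFin \o (fun x =>
    (-1) ^+ k * (q x ^+ (k ^ 2 + 'C(k, 2)) + q x ^+ (k ^ 2 + 'C(k.+1, 2))))).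
  by move=> kn; exact: (integrableZl mA ((-1) ^+ k) (intEk k kn)).
have [iS RS] := Rintegral_sum _ _ _ intS.
have [iE RE] := Rintegral_sum _ _ _ intE.
rewrite (funext SE); split; first exact: (integrableB mA iS iE).
rewrite RintegralB// RS RE.
have -> : \sum_(i <- index_iota 1 n.+1) \int[mu]_(x in A) ((-1) ^+ i *
     (q x ^+ (i ^ 2 + 'C(i, 2)) + q x ^+ (i ^ 2 + 'C(i.+1, 2)))) =
   \sum_(1 <= k < n.+1) (-1) ^+ k * (c (k ^ 2 + 'C(k, 2)) + c (k ^ 2 + 'C(k.+1, 2))).
  apply: eq_big_seq => k kn; have k0 := ksq _ kn.
  rewrite RintegralZl//; last exact: intEk.
  by rewrite RintegralD// ?Rint_q// ?addn_gt0 ?k0//; apply: integrable_q; rewrite addn_gt0 k0.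
rewrite subrK (le_trans (ler_norm_sum _ _ _))//.
rewrite big_seq [leRHS]big_seq; apply: ler_sum => s; rewrite mem_index_iota => /andP[s0 _].
have e0 : (0 < s * n + 'C(s.+1, 2))%N by rewrite addn_gt0 bin_gt0 orbC ltnS s0.
rewrite RintegralZl//; last exact: integrable_shanks.
rewrite normrM normrX normrN1 expr1n mul1r -Rint_q//.
rewrite (le_trans (le_normr_Rintegral _ _))//; first exact: integrable_shanks.
apply: le_Rintegral => //.
- exact/integrable_norm/integrable_shanks.
- exact: integrable_q.
- by move=> x Ax; exact: shanks_term_bound.
Qed.

End integrate_product.

(** * The integrals of exp(-n t) and exp(-n sqrt t) over the half-line *)

Section exponential_integrals.
Context {R : realType}.
Let mu := @lebesgue_measure R.

Let expR_pow (x : R) n : expR (- x) ^+ n = expR (- (n%:R * x)).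
Proof. by rewrite -expRM_natl mulrN. Qed.

Let is_derive_linexp (a x : R) : is_derive x 1 (fun x => expR (- (a * x)))
  (- a * expR (- (a * x))).
Proof.
have d : is_derive x 1 (fun x : R => - (a * x)) (- a).
  rewrite (_ : (fun x => _) = (- a) \*: (@id R)).
    by apply: (is_derive_eq (is_deriveZ (- a) (is_derive_id x 1))); rewrite scaleRE mulr1.
  by apply/funext => y /=; rewrite scaleRE mulNr.
have D : is_derive x 1 (expR \o (fun x : R => - (a * x))) _ :=
  is_derive1_comp (is_derive_expR _) d.
by apply: (is_derive_eq D); rewrite mulrC.
Qed.

Let continuous_linexp (a : R) : continuous (fun x => expR (- (a * x))).
Proof.
move=> x; apply: differentiable_continuous; rewrite -derivable1_diffP.
exact: (@ex_derive _ _ _ _ _ _ _ (is_derive_linexp a x)).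
Qed.

Let cvg_linexp (a : R) : 0 < a -> (1 + a * x) * expR (- (a * x)) @[x --> +oo] --> (0 : R).
Proof.
move=> a0.
apply: (@squeeze_cvgr _ _ _ _ (fun=> 0) (fun x => 4 / a * x^-1)).
- near=> x.
  have x0 : 0 < x by [].
  have ax : 0 < a * x by rewrite mulr_gt0.
  rewrite mulr_ge0 ?expR_ge0 ?addr_ge0 ?(ltW ax)//=.
  rewrite expRN ler_pdivrMr ?expR_gt0//.
  have -> : 4 / a * x^-1 = 4 / (a * x) by field; rewrite !lt0r_neq0.
  rewrite mulrAC ler_pdivlMr//.
  (* Halving the exponent gives exp(ax) = exp(ax/2)^2 >= (1 + ax/2)^2, whose quadratic growth beats
     the linear factor. *)
  have -> : a * x = a * x / 2 + a * x / 2 by field.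
  rewrite expRD -expr2.
  have := expR_ge1Dx (a * x / 2).
  set y := a * x / 2; have y0 : 0 < y by rewrite /y divr_gt0.
  set e := expR y => ye.
  by nra.
- exact: cvg_cst.
- rewrite -(mulr0 (4 / a)); apply: cvgMr.
  by apply/gtr0_cvgV0; [exact: nbhs_pinfty_gt|exact: cvg_id].
Unshelve. all: by end_near. Qed.

Lemma integral_expR_pow (n : nat) : (0 < n)%N ->
  (\int[mu]_(x in `[0%R, +oo[) (expR (- x) ^+ n)%:E = (n%:R^-1)%:E)%E.
Proof.
move=> n0; have a0 : 0 < n%:R :> R by rewrite ltr0n.
under eq_integral do rewrite expR_pow.
have dF (x : R) : is_derive x 1 ((- n%:R^-1) \*: (fun x => expR (- (n%:R * x))))
    (expR (- (n%:R * x))).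
  apply: (is_derive_eq (is_deriveZ _ (is_derive_linexp n%:R x))).
  by rewrite scaleRE; field; exact: lt0r_neq0.
rewrite (ge0_continuous_FTC2y (F := (- n%:R^-1) \*: (fun x => expR (- (n%:R * x)))) (l := 0)).
- by rewrite /= scaleRE mulr0 oppr0 expR0 mulr1 -EFinB sub0r opprK.
- by move=> x _; rewrite expR_ge0.
- exact/continuous_subspaceT/continuous_linexp.
- rewrite -(mulr0 (- n%:R^-1)); apply: cvgMr.
  apply: (@cvg_comp _ _ _ (fun x : R => n%:R * x) (fun y => expR (- y)) _ (pinfty_nbhs R)).
    by apply: gt0_cvgMry => //; exact: cvg_id.
  exact: cvgr_expR.
- by move=> x _; exact: (@ex_derive _ _ _ _ _ _ _ (dF x)).
- by apply/cvg_at_right_filter; apply: cvgMr; exact: continuous_linexp.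
- by move=> x _; rewrite derive1E; exact: (@derive_val _ _ _ _ _ _ _ (dF x)).
Qed.

(** Under x = s^2 the integrand becomes 2 s exp(-n s), with primitive [Phi]. The composite
    [Phi \o Num.sqrt] is differentiated only for x > 0; at 0 right continuity is enough. *)
Lemma integral_expR_sqrt_pow (n : nat) : (0 < n)%N ->
  (\int[mu]_(x in `[0%R, +oo[) (expR (- Num.sqrt x) ^+ n)%:E = (2 * n%:R ^- 2)%:E)%E.
Proof.
move=> n0; have a0 : 0 < n%:R :> R by rewrite ltr0n.
under eq_integral do rewrite expR_pow.
pose Phi : R -> R := (- 2 * n%:R ^- 2) \*:
  ((cst 1 + n%:R \*: (@id R)) * (fun x => expR (- (n%:R * x)))).
have dPhi (s : R) : is_derive s 1 Phi (2 * s * expR (- (n%:R * s))).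
  have d1 := is_deriveD (is_derive_cst (1 : R) s 1) (is_deriveZ n%:R (is_derive_id s 1)).
  have d2 := is_deriveZ (- 2 * n%:R ^- 2) (is_deriveM d1 (is_derive_linexp n%:R s)).
  refine (is_derive_eq d2 _).
  rewrite !fctE/= !scaleRE; field; exact: lt0r_neq0.
have dF (x : R) : 0 < x -> is_derive x 1 (Phi \o Num.sqrt) (expR (- (n%:R * Num.sqrt x))).
  move=> x0; apply: (is_derive_eq (is_derive1_comp (dPhi _) (is_derive1_sqrt x0))).
  by field; rewrite lt0r_neq0// sqrtr_gt0.
have cPhi : continuous (Phi \o Num.sqrt).
  move=> x; apply: continuous_comp; first exact: sqrt_continuous.
  apply: differentiable_continuous; rewrite -derivable1_diffP.
  exact: (@ex_derive _ _ _ _ _ _ _ (dPhi _)).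
have sqrt_y : Num.sqrt x @[x --> +oo] --> (+oo : set_system R).
  apply/cvgryPge => B; exists (B ^+ 2); split; first exact: num_real.
  move=> x /ltW Bx.
  by rewrite (le_trans (ler_norm B))// -sqrtr_sqr ler_wsqrtr.
rewrite (ge0_continuous_FTC2y (F := Phi \o Num.sqrt) (l := 0)).
- rewrite /Phi /= sqrtr0 !fctE/= !scaleRE !mulr0 oppr0 expR0 addr0 !mulr1 -EFinB; congr EFin.
  by ring.
- by move=> x _; rewrite expR_ge0.
- apply: continuous_subspaceT => x.
  apply: (@continuous_comp _ _ _ Num.sqrt (fun x => expR (- (n%:R * x)))).
    exact: sqrt_continuous.
  exact: continuous_linexp.
- apply: (cvg_comp _ _ sqrt_y).
  rewrite -(mulr0 (- 2 * n%:R ^- 2)); apply: cvgMr.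
  exact: cvg_linexp.
- by move=> x x0; exact: (@ex_derive _ _ _ _ _ _ _ (dF x x0)).
- exact/cvg_at_right_filter/cPhi.
- move=> x; rewrite in_itv/= andbT => x0; rewrite derive1E.
  exact: (@derive_val _ _ _ _ _ _ _ (dF x x0)).
Qed.

End exponential_integrals.

(** * Moments of the running maximum *)

Section exponential_cdf.
Context {R : realType}.

Lemma exponential_probI (r : R) (A : set R) :
  exponential_prob r A = exponential_prob r (A `&` `[0, +oo[).
Proof.
rewrite /exponential_prob integral_mkcondr; apply: eq_integral => x _.
rewrite patchE; case: ifPn => //; rewrite notin_setE/= in_itv/= andbT => /negP.
by rewrite -ltNge => x0; rewrite lt0_exponential_pdf.
Qed.

Lemma exponential_prob_le (r t : R) : 0 <= t ->
  exponential_prob r `]-oo, t] = (1 - expR (- (r * t)))%:E.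
Proof.
move=> t0; rewrite exponential_probI.
have -> : `]-oo, t] `&` `[0, +oo[ = `[0, t]%classic :> set R.
  apply/seteqP; split => x /=; rewrite !in_itv/= andbT; first by move=> [-> ->].
  by move=> /andP[-> ->].
move: t0; rewrite le_eqVlt => /predU1P[<-|t0].
  by rewrite set_itv1 /exponential_prob integral_set1 mulr0 oppr0 expR0 subrr.
by rewrite exponential_prob_itv0c// mulNr.
Qed.

Lemma exponential_prob_lt0 (r : R) : exponential_prob r `]-oo, 0[ = 0%E.
Proof.
rewrite exponential_probI (_ : _ `&` _ = set0) ?/exponential_prob ?integral_set0//.
apply/seteqP; split => x //=; rewrite !in_itv/= andbT => -[x0].
by rewrite leNgt x0.
Qed.

End exponential_cdf.

Section running_max.
Context d (T : measurableType d) (R : realType) (P : probability T R).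
Variable X : nat -> {RV P >-> R}.

(** Starting at 0 makes the maximum nonnegative everywhere, not only almost surely, as the tail
    formula for the expectation requires. *)
Fixpoint running_max (n : nat) (w : T) : R :=
  if n is m.+1 then Num.max (running_max m w) (X m w) else 0.

Lemma running_max_ge0 n w : 0 <= running_max n w.
Proof. by elim: n => //= n IH; rewrite le_max IH. Qed.

Lemma running_max_le n w t : 0 <= t ->
  running_max n w <= t <-> (forall i, (i < n)%N -> X i w <= t).
Proof.
move=> t0; elim: n => [|n IH]/=; first by split.
rewrite ge_max; split=> [/andP[/IH Mt Xt] i|Xt].
  by rewrite ltnS leq_eqVlt => /predU1P[->|/Mt].
by apply/andP; split; [apply/IH => i /ltnW; exact: Xt|exact: Xt].
Qed.

Lemma running_max_nd w : nondecreasing_seq (running_max ^~ w).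
Proof. by apply/nondecreasing_seqP => n /=; rewrite le_max lexx. Qed.

Lemma measurable_running_max n : measurable_fun setT (running_max n).
Proof.
elim: n => [|n IH]; first exact: measurable_cst.
exact: measurable_maxr.
Qed.

Hypothesis indep : mutually_independent P (fun i => (X i : T -> R)).
Hypothesis expX : forall (i : nat) (A : set R), measurable A ->
  distribution P (X i) A = exponential_prob (i.+1%:R : R) A.

Lemma running_max_cdf n (t : R) : 0 <= t ->
  P [set w | running_max n w <= t] =
  (\prod_(i < n) (1 - expR (- t) ^+ i.+1))%:E.
Proof.
move=> t0.
pose F : {fset nat} := [fset i in iota 0 n]%fset.
have FE i : (i \in F) = (i < n)%N by rewrite inE/= mem_iota add0n.
have -> : [set w | running_max n w <= t] =
    \bigcap_(i in [set` F]) ((X i : T -> R) @^-1` `]-oo, t]).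
  apply/seteqP; split => w /=.
    by move=> /(running_max_le _ _ _ t0) h i /=; rewrite FE in_itv/=; exact: h.
  move=> h; apply/(running_max_le _ _ _ t0) => i i_n.
  by have := h i; rewrite /= FE in_itv/=; exact.
rewrite indep//.
have -> : (\big[*%E/1%E]_(i <- F) P ((X i : T -> R) @^-1` `]-oo, t]) =
    \big[*%E/1%E]_(i <- F) ((1 - expR (- t) ^+ i.+1)%:E))%E.
  apply: eq_bigr => i _.
  rewrite -[LHS]/(distribution P (X i) `]-oo, t]%classic) expX//.
  by rewrite exponential_prob_le// -expRM_natl mulrN.
rewrite (perm_big (iota 0 n))/=; last first.
  by apply: uniq_perm => [||i]; rewrite ?fset_uniq ?iota_uniq// FE mem_iota add0n.
rewrite -{1}(subn0 n) -/(index_iota 0 n) big_mkord.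
by elim/big_ind2 : _ => // x1 x2 y1 y2 -> ->.
Qed.

HB.instance Definition _ n :=
  isMeasurableFun.Build _ _ _ _ (running_max n) (measurable_running_max n).

Let mu := @lebesgue_measure R.

(** [Y] is an increasing function of the maximum and [h] its inverse: the identity with [id], then
    the square with [Num.sqrt]. E(Y) is the integral of P(Y > t) = P(M_n > h t), to which the
    pentagonal estimate applies with q = exp(- h t). *)
Lemma expectation_running_max n (Y : {RV P >-> R}) (h : R -> R) (c : nat -> R) :
  (forall w, 0 <= Y w) -> (forall t, 0 <= t -> 0 <= h t) ->
  (forall t w, 0 <= t -> (Y w <= t) = (running_max n w <= h t)) ->
  measurable_fun setT h ->
  (forall k, (0 < k)%N ->
    (\int[mu]_(x in `[0%R, +oo[) (expR (- h x) ^+ k)%:E = (c k)%:E)%E) ->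
  exists2 e : R, ('E_P[Y] = e%:E)%E &
  `|e + \sum_(1 <= k < n.+1) (-1) ^+ k * (c (k ^ 2 + 'C(k, 2))%N + c (k ^ 2 + 'C(k.+1, 2))%N)|
  <= \sum_(1 <= s < n.+1) c (s * n + 'C(s.+1, 2))%N.
Proof.
move=> Y0 h0 Yh mh hc.
have mq : measurable_fun (`[0%R, +oo[%classic : set R) (fun x => expR (- h x)).
  apply: (measurable_funS measurableT) => //.
  apply: measurableT_comp => //; exact: measurableT_comp.
have q01 x : `[0%R, +oo[%classic x -> 0 <= expR (- h x) <= 1.
  rewrite /= in_itv/= andbT => /h0 hx.
  by rewrite expR_ge0 -expR0 ler_expR oppr_le0.
have [int_prod bound] := integral_prod_pentagonal _ _ _ mu _
  (measurable_itv `[0%R, +oo[) _ _ mq q01 hc n.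
exists (\int[mu]_(x in `[0%R, +oo[) (1 - \prod_(i < n) (1 - expR (- h x) ^+ i.+1))) => //.
rewrite ge0_expectation_ccdf// /Rintegral fineK; last first.
  exact: (integrable_fin_num _ int_prod).
apply: eq_integral => t; rewrite inE/= in_itv/= andbT => t0.
rewrite ccdf_1_cdf EFinB -(running_max_cdf _ _ (h0 _ t0)); congr (1 - P _)%E.
by apply/seteqP; split => w /=; rewrite in_itv/= Yh.
Qed.

(** Twice the harmonic number H_n over n. It dominates both remainders, since the exponents are at
    least s n and 2/(s n)^2 <= 2/(s n). *)
Definition moment_error (n : nat) : R := 2 * (\sum_(1 <= s < n.+1) s%:R^-1 / n%:R).

Lemma natr_pent_lo k : (k ^ 2 + 'C(k, 2))%:R = pent_lo k :> R.
Proof.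
rewrite natrD natrX /pent_lo.
suff -> : 'C(k, 2)%:R = k%:R * (k%:R - 1) / 2 :> R by field.
elim: k => [|k IH]; first by rewrite bin0n !mul0r.
by rewrite binS bin1 natrD IH -natr1; field.
Qed.

Lemma natr_pent_hi k : (k ^ 2 + 'C(k.+1, 2))%:R = pent_hi k :> R.
Proof. by rewrite binS bin1 addnA natrD natr_pent_lo /pent_lo /pent_hi; field. Qed.

Lemma running_max_moment1 n : exists2 e : R, ('E_P[running_max n] = e%:E)%E &
  `|e + pent_sum 1 n| <= moment_error n.
Proof.
have [|||||e Ee eb] := @expectation_running_max n (running_max n) id (fun k => k%:R^-1).
- exact: running_max_ge0.
- by [].
- by [].
- exact: measurable_id.
- exact: integral_expR_pow.
exists e => //; rewrite /pent_sum.
under eq_bigr do rewrite !expr1 -natr_pent_lo -natr_pent_hi.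
rewrite (le_trans eb)// /moment_error mulr_sumr big_nat [leRHS]big_nat.
apply: ler_sum => s /andP[s0]; rewrite ltnS => sn.
have s0' : 0 < s%:R :> R by rewrite ltr0n.
have n0' : 0 < n%:R :> R by rewrite ltr0n (leq_trans s0).
rewrite natrD natrM -invfM.
have c0 := ler0n R 'C(s.+1, 2).
have sn0 : 0 < s%:R * n%:R :> R by rewrite mulr_gt0.
apply: (@le_trans _ _ (s%:R * n%:R)^-1).
  by rewrite lef_pV2 ?posrE ?ltr_wpDr// lerDl.
by rewrite ler_peMl ?ler1n// invr_ge0 ltW.
Qed.

Lemma running_max_moment2 n : exists2 e : R, ('E_P[fun w => running_max n w ^+ 2]%R = e%:E)%E &
  `|e + 2 * pent_sum 2 n| <= moment_error n.
Proof.
have [|||||e Ee eb] := @expectation_running_max n ((running_max n : {mfun T >-> R}) ^+ 2)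
   Num.sqrt (fun k => 2 * k%:R ^- 2).
- by move=> w; rewrite sqr_ge0.
- by move=> t _; exact: sqrtr_ge0.
- move=> t w t0.
  transitivity (running_max n w ^+ 2 <= Num.sqrt t ^+ 2); first by rewrite sqr_sqrtr.
  rewrite ler_pXn2r// nnegrE ?sqrtr_ge0//.
  exact: running_max_ge0.
- by apply: continuous_measurable_fun; exact: sqrt_continuous.
- exact: integral_expR_sqrt_pow.
exists e => //.
rewrite /pent_sum mulr_sumr.
under eq_bigr do rewrite -natr_pent_lo -natr_pent_hi mulrCA mulrDr.
rewrite (le_trans eb)// /moment_error mulr_sumr big_nat [leRHS]big_nat.
apply: ler_sum => s /andP[s0]; rewrite ltnS => sn.
have s0' : 1 <= s%:R :> R by rewrite ler1n.
have n0' : 1 <= n%:R :> R by rewrite ler1n (leq_trans s0).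
rewrite natrD natrM -invfM.
have c0 := ler0n R 'C(s.+1, 2).
have sn0 : 1 <= s%:R * n%:R :> R by rewrite mulr_ege1.
rewrite ler_pM2l// lef_pV2 ?posrE; [|nra..].
by nra.
Qed.

(** H_n / n is a Cesaro mean of the harmonic sequence, which tends to 0. *)
Lemma moment_error_cvg : moment_error n @[n --> \oo] --> 0.
Proof.
have := cesaro (@cvg_harmonic R); rewrite /arithmetic_mean => H.
rewrite -(mulr0 2); apply: cvgMr.
rewrite -cvg_shiftS.
apply: cvg_trans H; apply: near_eq_cvg; near=> n.
rewrite /series/= big_add1 mulr_sumr.
by apply: eq_bigr => i _; rewrite mulrC.
Unshelve. all: by end_near. Qed.

End running_max.

(** * Passage to the supremum *)

Section limit_moments.
Context d (T : measurableType d) (R : realType) (P : probability T R).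
Variable X : nat -> {RV P >-> R}.
Hypothesis indep : mutually_independent P (fun i => (X i : T -> R)).
Hypothesis expX : forall (i : nat) (A : set R), measurable A ->
  distribution P (X i) A = exponential_prob (i.+1%:R : R) A.

Let Xf : nat -> T -> R := fun i => X i.
(* The second series is evaluated along even truncations only. *)
Let M m := @running_max _ _ _ P X m.*2.

Let M_nd w : nondecreasing_seq (M ^~ w).
Proof. by move=> m n mn; apply: running_max_nd; rewrite leq_double. Qed.

Lemma measurable_sup_family : measurable_fun setT (sup_family Xf).
Proof.
apply: measurableT_comp => //.
rewrite (_ : esup_family Xf = (fun w => esups (fun i => (X i w)%:E) 0)).
  by apply: measurable_fun_esups => n; exact/measurable_EFinP.
apply/funext => w; rewrite /esup_family /esups /sdrop /=; congr ereal_sup.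
by apply/seteqP; split => _ [i _ <-]; exists i.
Qed.

Lemma ae_X0_ge0 : {ae P, forall w, 0 <= X 0 w}.
Proof.
exists (X 0 @^-1` `]-oo, 0[); split.
- exact: measurable_funPTI.
- by have := expX 0 `]-oo, 0[ (measurable_itv _); rewrite exponential_prob_lt0.
- by move=> w /= /negP; rewrite -ltNge in_itv.
Qed.

Lemma running_max_cvg_esup w : 0 <= X 0 w -> (M m w)%:E @[m --> \oo] --> esup_family Xf w.
Proof.
move=> X0.
have -> : esup_family Xf w = ereal_sup (range (fun m => (M m w)%:E)).
  have sup_ge i : ((X i w)%:E <= esup_family Xf w)%E.
    by apply: ereal_sup_ubound; exists i.
  apply/eqP; rewrite eq_le; apply/andP; split; apply: ge_ereal_sup => _ [i _ <-].
    apply: (@le_trans _ _ (M i.+1 w)%:E); last by apply: ereal_sup_ubound; exists i.+1.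
    rewrite lee_fin (le_trans _ (@running_max_nd _ _ _ P X w i.+1 i.+1.*2 _))//=.
      by rewrite le_max lexx orbT.
    by rewrite -addnn leq_addr.
  rewrite /M; elim: i.*2 => [|j IH]/=.
    (* The initial value 0 of the running maximum lies below the supremum because [X 0 w] is
       nonnegative. *)
    by rewrite (le_trans _ (sup_ge 0%N))// lee_fin.
  by rewrite EFin_max ge_max IH sup_ge.
by apply: ereal_nondecreasing_cvgn => m n mn; rewrite lee_fin M_nd.
Qed.

Let double_cvg : m.*2 @[m --> \oo] --> \oo.
Proof.
apply/cvgnyPge => A; near=> m; rewrite -addnn (leq_trans _ (leq_addr _ _))//.
by near: m; exact: nbhs_infty_ge.
Unshelve. all: by end_near. Qed.

Let moment_cvg (e s : nat -> R) (l : R) :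
  (forall n, `|e n + s n| <= moment_error R n) -> s m.*2 @[m --> \oo] --> l ->
  (e m.*2)%:E @[m --> \oo] --> (- l)%:E.
Proof.
move=> es sl; apply: cvg_EFin; first exact: nearW.
have r0 := cvg_comp _ _ double_cvg (moment_error_cvg R).
have d0 : e m.*2 + s m.*2 @[m --> \oo] --> 0.
  apply/norm_cvg0P; apply: (@squeeze_cvgr _ _ _ _ (fun=> 0) (fun m => moment_error R m.*2)) => //.
    by near=> m; rewrite normr_ge0 es.
  exact: cvg_cst.
rewrite (_ : fine \o _ = (fun m => e m.*2 + s m.*2) - (fun m => s m.*2)).
  by rewrite -[- l]add0r; exact: cvgB d0 sl.
by apply/funext => m; rewrite !fctE/= addrK.
Unshelve. all: by end_near. Qed.

Let e1_cvg : ('E_P[M m])%E @[m --> \oo] --> (4 * Num.sqrt 3 / 3 * pi - 6)%:E.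
Proof.
have H n := running_max_moment1 _ _ _ P X indep expX n.
pose e n := s2val (cid2 (H n)).
rewrite (_ : (fun m => _) = (fun m => (e m.*2)%:E)); last first.
  by apply/funext => m; exact: (s2valP (cid2 (H m.*2))).
rewrite (_ : _ - 6 = - (6 - 4 * pi / Num.sqrt 3)).
  apply: (moment_cvg e (pent_sum 1)) => [n|]; first exact: (s2valP' (cid2 (H n))).
  exact: (cvg_comp _ _ double_cvg pent_sum1_cvg).
have s0 := lt0r_neq0 (@sqrt3_gt0 R); have s2 := @sqr_sqrt3 R.
move: (@pi R) => p; rewrite -{2}s2.
by field.
Qed.

Let e2_cvg : ('E_P[fun w => M m w ^+ 2]%R)%E @[m --> \oo] -->
   (- 4 * pi ^+ 2 + 216 - 32 * Num.sqrt 3 * pi)%:E.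
Proof.
have H n := running_max_moment2 _ _ _ P X indep expX n.
pose e n := s2val (cid2 (H n)).
rewrite (_ : (fun m => _) = (fun m => (e m.*2)%:E)); last first.
  by apply/funext => m; exact: (s2valP (cid2 (H m.*2))).
rewrite (_ : _ - _ = - (2 * (2 * pi ^+ 2 - 108 + 48 * pi / Num.sqrt 3))).
  apply: (moment_cvg e (fun n => 2 * pent_sum 2 n)) => [n|].
    exact: (s2valP' (cid2 (H n))).
  apply: cvgMr; exact: pent_sum2_double_cvg.
have s0 := lt0r_neq0 (@sqrt3_gt0 R); have s2 := @sqr_sqrt3 R.
have -> : 48 * pi / Num.sqrt 3 = 48 * pi / Num.sqrt 3 ^+ 2 * Num.sqrt 3 :> R.
  by move: (@pi R) => p; field.
by rewrite s2; move: (@pi R) => p; field.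
Qed.

(** Where the supremum is infinite, [fine] returns 0 and convergence fails. Monotone convergence
    gives the limit a finite expectation, so this set is negligible. *)
Lemma ae_running_max_cvg : {ae P, forall w, M m w @[m --> \oo] --> sup_family Xf w}.
Proof.
pose L w := limn (fun m => (M m w)%:E).
have L0 w : (0 <= L w)%E.
  apply: lime_ge; last by apply: nearW => m; rewrite lee_fin running_max_ge0.
  by apply: ereal_nondecreasing_is_cvgn => m n mn; rewrite lee_fin M_nd.
have mL : measurable_fun setT L.
  apply: (emeasurable_fun_cvg (fun m w => (M m w)%:E)).
    by move=> m; apply/measurable_EFinP; exact: measurable_running_max.
  by move=> w _; apply: ereal_nondecreasing_is_cvgn => m n mn; rewrite lee_fin M_nd.
have intL : (\int[P]_w L w = (4 * Num.sqrt 3 / 3 * pi - 6)%:E)%E.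
  rewrite monotone_convergence//.
  - apply/cvg_lim => //; move: e1_cvg; under eq_fun do rewrite unlock. exact.
  - by move=> m; apply/measurable_EFinP; exact: measurable_running_max.
  - by move=> m w _; rewrite lee_fin running_max_ge0.
  - by move=> w _ m n mn; rewrite lee_fin M_nd.
have : P.-integrable setT L.
  apply/integrableP; split => //.
  by under eq_integral do rewrite gee0_abs//; rewrite intL ltry.
move=> /(integrable_ae measurableT) Lfin.
apply: filterS2 ae_X0_ge0 Lfin => w X0 /(_ I).
have cM := running_max_cvg_esup w X0.
rewrite /L (cvg_lim _ cM)// => fM.
have cM' : (M m w)%:E @[m --> \oo] --> (sup_family Xf w)%:E.
  by rewrite /sup_family fineK.
exact: (fine_cvg cM').
Qed.

Lemma sup_family_moment (p : nat) (l : R) :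
  ('E_P[fun w => M m w ^+ p]%R)%E @[m --> \oo] --> l%:E ->
  P.-integrable setT (EFin \o (fun w => sup_family Xf w ^+ p)) /\
  ('E_P[fun w => sup_family Xf w ^+ p]%R = l%:E)%E.
Proof.
move=> El.
pose L w := limn (fun m => (M m w ^+ p)%:E).
have Mp_nd w : nondecreasing_seq (fun m => (M m w ^+ p)%:E).
  by move=> m n mn; rewrite lee_fin lerXn2r ?nnegrE ?running_max_ge0// M_nd.
have mM m : measurable_fun setT (fun w => (M m w ^+ p)%:E).
  by apply/measurable_EFinP/measurable_funX; exact: measurable_running_max.
have L0 w : (0 <= L w)%E.
  apply: lime_ge; first exact: ereal_nondecreasing_is_cvgn.
  by apply: nearW => m; rewrite lee_fin exprn_ge0// running_max_ge0.
have mL : measurable_fun setT L.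
  apply: (emeasurable_fun_cvg (fun m w => (M m w ^+ p)%:E)) => //.
  by move=> w _; exact: ereal_nondecreasing_is_cvgn.
have intL : (\int[P]_w L w = l%:E)%E.
  rewrite monotone_convergence//.
  - by apply/cvg_lim => //; move: El; under eq_fun do rewrite unlock.
  - by move=> m w _; rewrite lee_fin exprn_ge0// running_max_ge0.
(* The monotone limit of the p-th powers is almost surely the p-th power of the real-valued
   supremum, by continuity of the power. *)
have SL : ae_eq P setT (EFin \o (fun w => sup_family Xf w ^+ p)) L.
  apply: filterS ae_running_max_cvg => w cM _ /=.
  apply/esym/cvg_lim => //; apply: cvg_EFin; first exact: nearW.
  exact: (cvg_comp _ _ cM (@exprn_continuous R p _)).
have mS : measurable_fun setT (EFin \o (fun w => sup_family Xf w ^+ p)).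
  by apply/measurable_EFinP/measurable_funX; exact: measurable_sup_family.
split; last by rewrite unlock (ae_eq_integral L).
apply/integrableP; split => //.
rewrite (ae_eq_integral L) ?intL ?ltry//; first exact: measurableT_comp.
by apply: filterS SL => w /[apply] ->; rewrite gee0_abs.
Qed.

Lemma sup_family_mean_var :
  ('E_P[sup_family Xf] = (4 * Num.sqrt 3 / 3 * pi - 6)%:E)%E /\
  ('V_P[sup_family Xf] =
     (- (28 / 3) * pi ^+ 2 - 16 * Num.sqrt 3 * pi + 180)%:E)%E.
Proof.
have [i1 E1] := sup_family_moment 1 _ e1_cvg.
have [i2 E2] := sup_family_moment 2 _ e2_cvg.
have L1 : sup_family Xf \in Lfun P 1 by exact/Lfun1_integrable.
(* [x ^+ 1] is convertible to [x], so the case p = 1 is the mean itself. *)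
split; first exact: E1.
(* The variance is E(M^2) - E(M)^2, where the square of the mean contributes (16/3) pi^2, so that
   the coefficient of pi^2 is -4 - 16/3 = -28/3. *)
rewrite /variance covarianceE//; last exact/Lfun1_integrable.
rewrite [X in (X * _)%E]E1 [X in (_ * X)%E]E1 [X in (X - _)%E]E2 -EFinM -EFinB; congr EFin.
have s2 := @sqr_sqrt3 R.
have -> : (4 * Num.sqrt 3 / 3 * pi - 6) * (4 * Num.sqrt 3 / 3 * pi - 6) =
    16 / 9 * Num.sqrt 3 ^+ 2 * pi ^+ 2 - 16 * Num.sqrt 3 * pi + 36 :> R.
  by move: (@pi R) => p; field.
by rewrite s2; move: (@pi R) => p; field.
Qed.

End limit_moments.

(* Indices are shifted: X i (i : nat) is the paper's X_{i+1} ~ Exp(i+1). *)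
Theorem theorem1 (R : realType) (d : measure_display) (T : measurableType d)
  (P : probability T R) (X : nat -> {RV P >-> R}) :
  mutually_independent P (fun i => (X i : T -> R)) ->
  (forall (i : nat) (A : set R), measurable A ->
     distribution P (X i) A = exponential_prob (i.+1%:R : R) A) ->
  ('E_P[sup_family (fun i => (X i : T -> R))]
     = (4 * Num.sqrt 3 / 3 * pi - 6)%:E)%E /\
  ('V_P[sup_family (fun i => (X i : T -> R))]
     = (- (28 / 3) * pi ^+ 2 - 16 * Num.sqrt 3 * pi + 180)%:E)%E.
Proof. exact: sup_family_mean_var. Qed.
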